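(* Let $k$ and $r$ be positive integers. Then, as formal power series in $q$ (equivalently, for complex $|q|<1$), $$(-q;q)_\infty \left( 1+2\sum_{j=1}^k (-1)^j q^{r j^2} \right) = \frac{(-q;q)_\infty (q^r;q^r)_\infty}{(-q^r;q^r)_\infty} + 2(-1)^k q^{r(k+1)^2} \frac{(q^r;q^{2r})_\infty}{(q;q^2)_\infty} \sum_{j=0}^{\infty}\frac{q^{(2k+2j+3)rj}}{(q^{2r};q^{2r})_j(q^r;q^{2r})_{k+j+1}}.$$
   Context: The $q$-Pochhammer symbol is $(a;q)_0=1$, $(a;q)_n=(1-a)(1-aq)\cdots(1-aq^{n-1})$ for $n>0$, and $(a;q)_\infty=\lim_{n\to\infty}(a;q)_n$. *)

(* Defs.v *)
From HB Require Import structures.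
From mathcomp Require Import all_boot all_order all_algebra.
From mathcomp Require Import boolp classical_sets.
Set Implicit Arguments.
Unset Strict Implicit.
Unset Printing Implicit Defensive.
Import GRing.Theory.
Local Open Scope ring_scope.

(* {fps R} is the ring R[[q]]; p n is the coefficient of q^n in p. *)
Record fps (R : Type) := Fps { coefs :> nat -> R }.
Notation "{ 'fps' R }" := (fps R) (format "{ 'fps'  R }") : type_scope.

Lemma fpsP (R : Type) (p s : {fps R}) : (forall n, p n = s n) <-> p = s.
Proof.
split=> [|-> //]; case: p s => [p] [s] /= eq_ps.
by congr Fps; apply: funext.
Qed.

HB.instance Definition _ (R : Type) := gen_eqMixin {fps R}.
HB.instance Definition _ (R : Type) := gen_choiceMixin {fps R}.

Section FpsRing.
Variable R : comUnitRingType.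
Implicit Types p s t : {fps R}.

Definition fps_zero : {fps R} := Fps (fun=> 0).
Definition fps_opp p : {fps R} := Fps (fun n => - p n).
Definition fps_add p s : {fps R} := Fps (fun n => p n + s n).
Definition fps_one : {fps R} := Fps (fun n => (n == 0%N)%:R).
Definition fps_mul p s : {fps R} :=
  Fps (fun n => \sum_(i < n.+1) p i * s (n - i)%N).

Fact fps_addA : associative fps_add.
Proof. by move=> p s t; apply/fpsP => n /=; rewrite addrA. Qed.
Fact fps_addC : commutative fps_add.
Proof. by move=> p s; apply/fpsP => n /=; rewrite addrC. Qed.
Fact fps_add0 : left_id fps_zero fps_add.
Proof. by move=> p; apply/fpsP => n /=; rewrite add0r. Qed.
Fact fps_addN : left_inverse fps_zero fps_opp fps_add.
Proof. by move=> p; apply/fpsP => n /=; rewrite addNr. Qed.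
HB.instance Definition _ := GRing.isZmodule.Build {fps R}
  fps_addA fps_addC fps_add0 fps_addN.

Definition fps_trunc N p : {poly R} := \poly_(i < N.+1) p i.

Lemma coef_fps_trunc N p i : (i <= N)%N -> (fps_trunc N p)`_i = p i.
Proof. by move=> leiN; rewrite coef_poly ltnS leiN. Qed.

Lemma fps_mul_trunc N p s n : (n <= N)%N ->
  fps_mul p s n = (fps_trunc N p * fps_trunc N s)`_n.
Proof.
move=> lenN; rewrite coefM /=; apply: eq_bigr => i _.
have lein : (i <= n)%N by rewrite -ltnS.
by rewrite !coef_fps_trunc ?(leq_trans (leq_subr _ _)) ?(leq_trans lein).
Qed.

Fact fps_mulC : commutative fps_mul.
Proof. by move=> p s; apply/fpsP => n; rewrite !(@fps_mul_trunc n) // mulrC. Qed.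
Fact fps_mulA : associative fps_mul.
Proof.
move=> p s t; apply/fpsP => n.
have -> : fps_mul p (fps_mul s t) n
    = (fps_trunc n p * (fps_trunc n s * fps_trunc n t))`_n.
  rewrite coefM /=; apply: eq_bigr => i _;
  by rewrite coef_fps_trunc; [rewrite -fps_mul_trunc ?leq_subr|rewrite -ltnS].
rewrite mulrA coefM /=; apply: eq_bigr => i _.
have lein : (i <= n)%N by rewrite -ltnS.
by rewrite coef_fps_trunc ?leq_subr // -fps_mul_trunc.
Qed.
Fact fps_mul1 : left_id fps_one fps_mul.
Proof.
move=> p; apply/fpsP => n /=; rewrite big_ord_recl big1 ?addr0 ?mul1r ?subn0 //.
by move=> i _; rewrite mul0r.
Qed.
Fact fps_mulDl : left_distributive fps_mul fps_add.
Proof.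
move=> p s t; apply/fpsP => n /=; rewrite -big_split /=.
by apply: eq_bigr => i _; rewrite mulrDl.
Qed.
Fact fps_oner_neq0 : fps_one != 0 :> {fps R}.
Proof.
by apply/eqP => /fpsP /(_ 0%N) /= /eqP; rewrite oner_eq0.
Qed.
HB.instance Definition _ := GRing.Zmodule_isComNzRing.Build {fps R}
  fps_mulA fps_mulC fps_mul1 fps_mulDl fps_oner_neq0.

(* The coefficients b_0, ..., b_n of 1/p, from p_0 b_0 = 1 and
   p_0 b_(n+1) = - (p_1 b_n + ... + p_(n+1) b_0). *)
Fixpoint fps_inv_seq p n : seq R :=
  if n is m.+1 then
    let b := fps_inv_seq p m in
    rcons b (- ((p 0%N)^-1 * \sum_(i < m.+1) p i.+1 * b`_(m - i)%N))
  else [:: (p 0%N)^-1].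

Definition fps_unit : pred {fps R} := fun p => p 0%N \is a GRing.unit.
Definition fps_inv p : {fps R} :=
  if fps_unit p then Fps (fun n => (fps_inv_seq p n)`_n) else p.

Lemma size_fps_inv_seq p n : size (fps_inv_seq p n) = n.+1.
Proof. by elim: n => //= n IHn; rewrite size_rcons IHn. Qed.

Lemma nth_fps_inv_seq p n i : (i <= n)%N ->
  (fps_inv_seq p n)`_i = (fps_inv_seq p i)`_i.
Proof.
elim: n => [|n IHn]; first by rewrite leqn0 => /eqP ->.
rewrite leq_eqVlt => /predU1P[-> //|ltin].
by rewrite /= nth_rcons size_fps_inv_seq ltin IHn.
Qed.

Fact fps_mulVr : {in fps_unit, left_inverse 1 fps_inv fps_mul}.
Proof.
move=> p; rewrite -topredE /= => Up; rewrite fps_mulC; apply/fpsP => -[|n].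
  by rewrite /fps_inv Up /= big_ord_recl big_ord0 addr0 /= mulrV.
rewrite /fps_inv Up [LHS]/= big_ord_recl subn0 /=.
rewrite nth_rcons size_fps_inv_seq ltnn eqxx mulrN mulVKr // addrC.
apply/eqP; rewrite subr_eq0; apply/eqP; apply: eq_bigr => i _.
by rewrite subSS [in RHS]nth_fps_inv_seq ?leq_subr.
Qed.
Fact fps_unitP p s : s * p = 1 -> fps_unit p.
Proof.
move=> /fpsP /(_ 0%N); rewrite /= big_ord_recl big_ord0 addr0 => sp1.
by apply/unitrPr; exists (s 0%N); rewrite mulrC.
Qed.
Fact fps_inv_out : {in [predC fps_unit], fps_inv =1 id}.
Proof. by move=> p; rewrite inE /fps_inv => /negPf; rewrite -topredE /= => ->. Qed.
HB.instance Definition _ := GRing.ComNzRing_hasMulInverse.Build {fps R}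
  fps_mulVr fps_unitP fps_inv_out.

Lemma fps_unitE p : (p \is a GRing.unit) = (p 0%N \is a GRing.unit).
Proof. by []. Qed.

Definition fpsX : {fps R} := Fps (fun n => (n == 1%N)%:R).

(* Convergence in the q-adic topology: every coefficient is eventually
   constant. *)
Definition fps_cvg (u : nat -> {fps R}) (l : {fps R}) : Prop :=
  forall n, exists N, forall m, (N <= m)%N -> u m n = l n.

(* The q-adic limit of u, and 0 when u does not converge. *)
Definition fps_lim (u : nat -> {fps R}) : {fps R} :=
  xget 0 [set l | fps_cvg u l]%classic.

Lemma fps_cvg_lim u l : fps_cvg u l -> fps_lim u = l.
Proof.
move=> ul; apply: xget_unique => // l' ul'; apply/fpsP => n.
have [N uN] := ul n; have [N' uN'] := ul' n.
by rewrite -(uN (maxn N N')) ?leq_maxl // uN' ?leq_maxr.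
Qed.

Lemma fps_cvg_lim_ex u : (exists l, fps_cvg u l) -> fps_cvg u (fps_lim u).
Proof. by case=> l ul; rewrite (fps_cvg_lim ul). Qed.

Lemma fps_cvg_stable (u : nat -> {fps R}) :
  (forall n m, (n < m)%N -> u m.+1 n = u m n) -> fps_cvg u (fps_lim u).
Proof.
move=> u_st; apply: fps_cvg_lim_ex; exists (Fps (fun n => u n.+1 n)) => n /=.
exists n.+1 => m; elim: m => // m IHm.
by rewrite leq_eqVlt => /predU1P[[->] //|ltnm]; rewrite u_st ?IHm.
Qed.

Definition fps_series (f : nat -> {fps R}) : {fps R} :=
  fps_lim (fun N => \sum_(j < N) f j).

Lemma fps_series_cvg (f : nat -> {fps R}) :
  (forall j n, (n < j)%N -> f j n = 0) ->
  fps_cvg (fun N => \sum_(j < N) f j) (fps_series f).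
Proof.
move=> f0; apply: fps_cvg_stable => n m ltnm.
by rewrite big_ord_recr /= f0 // addr0.
Qed.

Lemma fps_mul_low p s (i n : nat) : (forall k, (k < i)%N -> s k = 0) -> (n < i)%N ->
  (p * s) n = 0.
Proof.
move=> s0 ltni /=; rewrite big1 // => k _.
by rewrite s0 ?mulr0 // (leq_ltn_trans (leq_subr _ _)).
Qed.

Lemma fps_exp_low p i n : p 0%N = 0 -> (n < i)%N -> (p ^+ i) n = 0.
Proof.
move=> p0; elim: i n => // i IHi n ltni; rewrite exprS /= big_ord_recl p0 mul0r.
rewrite add0r big1 // => k _; rewrite IHi ?mulr0 // /bump /=.
by case: n k ltni => [[]//|n k ltni]; rewrite subSS (leq_ltn_trans (leq_subr _ _)).
Qed.

End FpsRing.

Arguments fpsX {R}.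

(* qpoch a b n = (a; b)_n and qpoch_inf a b = (a; b)_oo. *)
Definition qpoch (A : pzRingType) (a b : A) (n : nat) : A :=
  \prod_(i < n) (1 - a * b ^+ i).

Definition qpoch_inf (R : comUnitRingType) (a b : {fps R}) : {fps R} :=
  fps_lim (qpoch a b).

Lemma qpoch_cvg (R : comUnitRingType) (a b : {fps R}) :
  b 0%N = 0 -> fps_cvg (qpoch a b) (qpoch_inf a b).
Proof.
move=> b0; apply: fps_cvg_stable => n m ltnm.
have -> : qpoch a b m.+1 = qpoch a b m - qpoch a b m * a * b ^+ m.
  by rewrite /qpoch big_ord_recr /= mulrBr mulr1 mulrA.
rewrite -[RHS]subr0 -(@fps_mul_low _ (qpoch a b m * a) (b ^+ m) m n) // => k.
exact: fps_exp_low.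
Qed.

(* Main.v *)
Require Import Defs.
From mathcomp Require Import all_boot all_order all_algebra.
From mathcomp Require Import ring zify.
Set Implicit Arguments.
Unset Strict Implicit.
Unset Printing Implicit Defensive.
Import GRing.Theory.
Local Open Scope ring_scope.

(* Write S(x, w) = \sum_j x^j p^(j^2) (w p^j; p)_oo / (p; p)_j and F(a) = S(a, a).
   Splitting off a factor of (w p^j; p)_oo gives F(a) + a F(ap) = S(a, ap), while
   inserting 1 = p^j + (1 - p^j) gives S(a, ap) = F(ap) + ap F(ap^2), which is
   S(ap, ap^2).  Hence S(a, ap) = S(a p^n, a p^(n+1)) for all n, so S(a, ap) = 1.
   With p = Q^2 and a = Q^(2i+1), where Q = q^r, this is
   F(Q^(2i+1)) + Q^(2i+1) F(Q^(2i+3)) = 1, which yields the theorem by induction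
   on k.  The start of the induction is 2 F(Q) = 1 + (Q; Q)_oo / (-Q; Q)_oo: up to
   the factor (Q; Q^2)_oo = 1 / (-Q; Q)_oo, the series F(Q) is the even part of
   Euler's series \sum_n z^n Q^(n(n+1)/2) / (Q; Q)_n = (-zQ; Q)_oo at z = 1. *)

(** * Algebra in commutative rings: the induction on [k] and the final rearrangements *)

Lemma truncated_theta_rec (A : comPzRingType) (Q G : A) (f : nat -> A) k :
    (forall i, f i + Q ^+ i.*2.+1 * f i.+1 = 1) -> G = 2 * f 0%N - 1 ->
  1 + 2 * \sum_(1 <= j < k.+1) (-1) ^+ j * Q ^+ (j ^ 2)
  = G + 2 * (-1) ^+ k * Q ^+ (k.+1 ^ 2) * f k.+1.
Proof.
move=> rec ->; have {}rec i : f i = 1 - Q ^+ i.*2.+1 * f i.+1.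
  by rewrite -(rec i) addrK.
elim: k => [|k IHk].
  by rewrite big_geq // (rec 0%N) exp1n; ring.
rewrite big_nat_recr // mulrDr addrA IHk (rec k.+1).
(* Consecutive squares differ here by 2k+3, the exponent of Q that the recurrence for [f k.+1]
   contributes. *)
have -> : (k.+2 ^ 2 = k.+1 ^ 2 + k.+1.*2.+1)%N by rewrite -mul2n; lia.
rewrite exprD [(-1) ^+ k.+1]exprS /=; ring.
Qed.

(** Final assembly: [E] = (-q; q)_oo, [E'] = (q; q^2)_oo, [P] = (Q; Q^2)_oo, [T] = F(Q^(2k+3)), and
    [U] is the series of the theorem. The factor [P] cancels the inverse contained in [U]. *)
Lemma cofactor_eq (A : comUnitRingType) (E E' S G H c P T U : A) :
    E'^-1 = E -> P \is a GRing.unit -> S = G / H + c * T -> U = P^-1 * T ->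
  E * S = E * G / H + c * (P / E') * U.
Proof.
move=> -> UP -> ->.
by rewrite -{1}(mulVKr UP T); ring.
Qed.

(** Used on the term of index j of the final series: [D * I] is (Q; Q^2)_oo split after k+j+1
    factors, [J] is (Q^2; Q^2)_j, and the tail [I] cancels. *)
Lemma invr_split_mul (A : comUnitRingType) (D I J x y : A) :
    D \is a GRing.unit -> I \is a GRing.unit -> J \is a GRing.unit ->
  (D * I)^-1 * (x * I / J * y) = x * y / (J * D).
Proof.
by move=> UD UI UJ; rewrite !invrM // -[RHS]mulr1 -(divrr UI); ring.
Qed.

(** * Limits and sums in the q-adic topology *)

Section Convergence.
Variable R : comUnitRingType.
Implicit Types (p s a b l x y : {fps R}) (u v f g : nat -> {fps R}).

(** Congruence modulo X^n, which ring operations preserve. *)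
Definition fps_eqmod n p s := forall i, (i < n)%N -> p i = s i.

Lemma fps_eqmodD n p p' s s' :
  fps_eqmod n p p' -> fps_eqmod n s s' -> fps_eqmod n (p + s) (p' + s').
Proof. by move=> pp' ss' i lin /=; rewrite pp' ?ss'. Qed.

Lemma fps_eqmodN n p p' : fps_eqmod n p p' -> fps_eqmod n (- p) (- p').
Proof. by move=> pp' i lin /=; rewrite pp'. Qed.

Lemma fps_eqmodM n p p' s s' :
  fps_eqmod n p p' -> fps_eqmod n s s' -> fps_eqmod n (p * s) (p' * s').
Proof.
move=> pp' ss' i lin /=; apply: eq_bigr => j _.
by rewrite pp' ?ss' //; apply: leq_ltn_trans lin; [exact: leq_subr|rewrite -ltnS].
Qed.

Lemma fps_eqmodMr n p p' s : fps_eqmod n p p' -> fps_eqmod n (p * s) (p' * s).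
Proof. by move=> /fps_eqmodM; apply. Qed.

Lemma fps_eqmodX n p p' m : fps_eqmod n p p' -> fps_eqmod n (p ^+ m) (p' ^+ m).
Proof.
by move=> pp'; elim: m => // m IHm; rewrite !exprS; apply: fps_eqmodM.
Qed.

(** Only finitely many coefficients lie below [n], so the maximum of their thresholds serves for all
    of them. *)
Lemma fps_cvg_eqmod u l : fps_cvg u l ->
  forall n, exists N, forall m, (N <= m)%N -> fps_eqmod n (u m) l.
Proof.
move=> ul; elim=> [|n [N IHn]]; first by exists 0%N.
have [M uM] := ul n; exists (maxn N M) => m; rewrite geq_max => /andP[Nm Mm] i.
by rewrite ltnS leq_eqVlt => /predU1P[->|]; [exact: uM|exact: IHn].
Qed.

Lemma eqmod_fps_cvg u l :
  (forall n, exists N, forall m, (N <= m)%N -> fps_eqmod n (u m) l) -> fps_cvg u l.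
Proof. by move=> ul n; have [N uN] := ul n.+1; exists N => m /uN; apply. Qed.

Lemma fps_cvg_unique u l l' : fps_cvg u l -> fps_cvg u l' -> l = l'.
Proof. by move=> /fps_cvg_lim <- /fps_cvg_lim. Qed.

Lemma fps_cvg_cst l : fps_cvg (fun=> l) l.
Proof. by move=> n; exists 0%N. Qed.

Lemma eq_fps_cvg u v l : u =1 v -> fps_cvg u l -> fps_cvg v l.
Proof. by move=> uv ul n; have [N uN] := ul n; exists N => m /uN; rewrite uv. Qed.

Lemma fps_cvg_sub (h : nat -> nat) u l : (forall n, (n <= h n)%N) ->
  fps_cvg u l -> fps_cvg (u \o h) l.
Proof.
move=> hh ul n; have [N uN] := ul n; exists N => m Nm.
exact/uN/(leq_trans Nm).
Qed.

Lemma fps_cvgD u v l l' :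
  fps_cvg u l -> fps_cvg v l' -> fps_cvg (fun n => u n + v n) (l + l').
Proof.
move=> /fps_cvg_eqmod ul /fps_cvg_eqmod vl; apply: eqmod_fps_cvg => n.
have [[N uN] [M vM]] := (ul n, vl n); exists (maxn N M) => m.
by rewrite geq_max => /andP[/uN ? /vM ?]; apply: fps_eqmodD.
Qed.

Lemma fps_cvgM u v l l' :
  fps_cvg u l -> fps_cvg v l' -> fps_cvg (fun n => u n * v n) (l * l').
Proof.
move=> /fps_cvg_eqmod ul /fps_cvg_eqmod vl; apply: eqmod_fps_cvg => n.
have [[N uN] [M vM]] := (ul n, vl n); exists (maxn N M) => m.
by rewrite geq_max => /andP[/uN ? /vM ?]; apply: fps_eqmodM.
Qed.

Lemma fps_eqmod_lim n u v l l' :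
  (forall m, fps_eqmod n (u m) (v m)) -> fps_cvg u l -> fps_cvg v l' ->
  fps_eqmod n l l'.
Proof.
move=> uv ul vl i lin; have [[N uN] [M vM]] := (ul i, vl i).
by rewrite -(uN (maxn N M)) ?leq_maxl // -(vM (maxn N M)) ?leq_maxr // uv.
Qed.

Lemma fps_cvg_geom a b : b 0%N = 0 -> fps_cvg (fun n => a * b ^+ n) 0.
Proof.
move=> b0 n; exists n.+1 => m ltnm.
by apply: (fps_mul_low _ _ ltnm) => i ltim; apply: fps_exp_low.
Qed.

Lemma fps_cvg_comp (F : {fps R} -> {fps R}) u l :
  (forall n x y, fps_eqmod n x y -> fps_eqmod n (F x) (F y)) ->
  fps_cvg u l -> fps_cvg (F \o u) (F l).
Proof.
move=> Fc /fps_cvg_eqmod ul; apply: eqmod_fps_cvg => n.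
by have [N uN] := ul n; exists N => m /uN /Fc.
Qed.

(** Iteration gives F(a) = F(a b^n); since a b^n tends to 0 and [F] preserves congruences, the limit
    is F(0). *)
Lemma fps_dilation_invariant (F : {fps R} -> {fps R}) a b : b 0%N = 0 ->
  (forall n x y, fps_eqmod n x y -> fps_eqmod n (F x) (F y)) ->
  (forall x, F x = F (x * b)) -> F a = F 0.
Proof.
move=> b0 Fc Fb; have it n : F a = F (a * b ^+ n).
  elim: n => [|n ->]; first by rewrite expr0 (mulr1 a).
  by rewrite Fb exprSr mulrA.
apply: (fps_cvg_unique (fps_cvg_cst (F a))).
by apply: eq_fps_cvg (fps_cvg_comp Fc (fps_cvg_geom a b0)) => n; rewrite /= -it.
Qed.

(** A relation that records convergence, whereas [fps_series] takes the value 0 on divergent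
    series. *)
Definition fps_sums f l := fps_cvg (fun N => \sum_(j < N) f j) l.

Lemma fps_sums_series f l : fps_sums f l -> fps_series f = l.
Proof. exact: fps_cvg_lim. Qed.

Lemma fps_sums_unique f l l' : fps_sums f l -> fps_sums f l' -> l = l'.
Proof. exact: fps_cvg_unique. Qed.

Lemma eq_fps_sums f g l : f =1 g -> fps_sums f l -> fps_sums g l.
Proof. by move=> fg; apply: eq_fps_cvg => N; apply: eq_bigr => i _. Qed.

Lemma fps_sumsD f g l l' :
  fps_sums f l -> fps_sums g l' -> fps_sums (fun j => f j + g j) (l + l').
Proof.
by move=> fl gl; apply: eq_fps_cvg (fps_cvgD fl gl) => N; rewrite big_split.
Qed.

Lemma fps_sumsZ a f l : fps_sums f l -> fps_sums (fun j => a * f j) (a * l).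
Proof.
move=> fl; apply: eq_fps_cvg (fps_cvgM (fps_cvg_cst a) fl) => N.
by rewrite mulr_sumr.
Qed.

Lemma fps_eqmod_sums n f g l l' : (forall j, fps_eqmod n (f j) (g j)) ->
  fps_sums f l -> fps_sums g l' -> fps_eqmod n l l'.
Proof.
move=> fg; apply: fps_eqmod_lim; elim=> [|m IHm]; first by rewrite !big_ord0.
by rewrite !big_ord_recr; apply: fps_eqmodD.
Qed.

Lemma fps_sums_recl f l : fps_sums (fun j => f j.+1) l -> fps_sums f (f 0%N + l).
Proof.
move=> /(fps_cvgD (fps_cvg_cst (f 0%N))) fl n; have [N fN] := fl n.
exists N.+1 => -[//|m] Nm; rewrite -(fN m Nm) big_ord_recl.
by congr (coefs (_ + _) n); apply: eq_bigr.
Qed.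

Lemma fps_sums_pow b f (h : nat -> nat) : b 0%N = 0 -> (forall j, (j <= h j)%N) ->
  fps_sums (fun j => f j * b ^+ h j) (fps_series (fun j => f j * b ^+ h j)).
Proof.
move=> b0 hh; apply: fps_series_cvg => j n ltnj.
apply: (fps_mul_low _ _ (leq_trans ltnj (hh j))) => i.
exact: fps_exp_low.
Qed.

End Convergence.

(** * Finite and infinite q-Pochhammer symbols *)

Section QPochhammer.
Variable R : comUnitRingType.
Implicit Types (p a b w x z Q : {fps R}).

Lemma qpoch0 a b : qpoch a b 0 = 1.
Proof. exact: big_ord0. Qed.

Lemma qpoch_recr a b n : qpoch a b n.+1 = qpoch a b n * (1 - a * b ^+ n).
Proof. by rewrite /qpoch big_ord_recr. Qed.

Lemma qpoch_recl a b n : qpoch a b n.+1 = (1 - a) * qpoch (a * b) b n.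
Proof.
rewrite /qpoch big_ord_recl expr0 mulr1; congr (_ * _).
by apply: eq_bigr => i _; rewrite exprS mulrA.
Qed.

Lemma qpoch_unit a b n : a 0%N = 0 -> qpoch a b n \is a GRing.unit.
Proof.
move=> a0; elim: n => [|n IHn]; first by rewrite qpoch0 unitr1.
rewrite qpoch_recr unitrM IHn fps_unitE /= big_ord_recl big_ord0 a0.
by rewrite mul0r addr0 subr0 unitr1.
Qed.

(** Aligns terms of index n and n+1 in the functional equations of the series below. *)
Lemma qpoch_invS b n : b 0%N = 0 ->
  (qpoch b b n)^-1 = (1 - b ^+ n.+1) / qpoch b b n.+1.
Proof.
move=> b0; apply: (mulrI (qpoch_unit b n b0)).
by rewrite mulrA divrr ?qpoch_unit // exprS -qpoch_recr divrr ?qpoch_unit.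
Qed.

Lemma qpoch_inf_unit a b :
  a 0%N = 0 -> b 0%N = 0 -> qpoch_inf a b \is a GRing.unit.
Proof.
move=> a0 b0; rewrite fps_unitE; have [N ab] := qpoch_cvg a b0 0%N.
by rewrite -(ab N) // -fps_unitE qpoch_unit.
Qed.

Lemma qpoch_inf_recl a b : b 0%N = 0 ->
  qpoch_inf a b = (1 - a) * qpoch_inf (a * b) b.
Proof.
move=> b0; apply: (@fps_cvg_unique _ (fun n => qpoch a b n.+1)).
  exact: (fps_cvg_sub leqnSn (qpoch_cvg a b0)).
apply: eq_fps_cvg (fps_cvgM (fps_cvg_cst (1 - a)) (qpoch_cvg (a * b) b0)) => n.
by rewrite qpoch_recl.
Qed.

Lemma qpoch_inf_split a b n : b 0%N = 0 ->
  qpoch_inf a b = qpoch a b n * qpoch_inf (a * b ^+ n) b.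
Proof.
move=> b0; elim: n => [|n ->]; first by rewrite qpoch0 mul1r mulr1.
have -> : a * b ^+ n.+1 = a * b ^+ n * b by rewrite exprSr mulrA.
by rewrite qpoch_recr (qpoch_inf_recl (a * b ^+ n)) // mulrA.
Qed.

Lemma qpoch_inf0 b : b 0%N = 0 -> qpoch_inf 0 b = 1.
Proof.
move=> b0; apply: (fps_cvg_unique (qpoch_cvg 0 b0)).
apply: eq_fps_cvg (fps_cvg_cst 1) => n.
by rewrite /qpoch big1 // => i _; rewrite mul0r subr0.
Qed.

Lemma qpoch_inf_eqmod b n a a' : b 0%N = 0 ->
  fps_eqmod n a a' -> fps_eqmod n (qpoch_inf a b) (qpoch_inf a' b).
Proof.
move=> b0 aa'; apply: fps_eqmod_lim (qpoch_cvg a b0) (qpoch_cvg a' b0) => m.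
elim: m => [|m IHm]; first by rewrite !qpoch0.
rewrite !qpoch_recr; apply: fps_eqmodM => //.
by apply: fps_eqmodD => //; apply: fps_eqmodN; apply: fps_eqmodM.
Qed.

Lemma qpoch_double a b n :
  qpoch a b n.*2 = qpoch a (b ^+ 2) n * qpoch (a * b) (b ^+ 2) n.
Proof.
elim: n => [|n IHn]; first by rewrite double0 !qpoch0 mul1r.
have E : b ^+ n.*2 = (b ^+ 2) ^+ n by rewrite -exprM mul2n.
rewrite doubleS !qpoch_recr IHn [b ^+ n.*2.+1]exprS E; ring.
Qed.

Lemma qpoch_sqr a b n : qpoch a b n * qpoch (- a) b n = qpoch (a ^+ 2) (b ^+ 2) n.
Proof.
elim: n => [|n IHn]; first by rewrite !qpoch0 mul1r.
rewrite !qpoch_recr -IHn exprAC; ring.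
Qed.

(** Combine (Q; Q)_oo (-Q; Q)_oo = (Q^2; Q^2)_oo with (Q; Q)_oo = (Q; Q^2)_oo (Q^2; Q^2)_oo, then
    cancel the unit (Q; Q)_oo. *)
Lemma qpoch_inf_euler Q : Q 0%N = 0 ->
  qpoch_inf (- Q) Q * qpoch_inf Q (Q ^+ 2) = 1.
Proof.
move=> Q0; have Q20 : (Q ^+ 2) 0%N = 0 by apply: fps_exp_low.
have sqr : qpoch_inf Q Q * qpoch_inf (- Q) Q = qpoch_inf (Q ^+ 2) (Q ^+ 2).
  apply: (fps_cvg_unique _ (qpoch_cvg (Q ^+ 2) Q20)).
  apply: eq_fps_cvg (fps_cvgM (qpoch_cvg Q Q0) (qpoch_cvg (- Q) Q0)) => n.
  exact: qpoch_sqr.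
have dbl : qpoch_inf Q Q = qpoch_inf Q (Q ^+ 2) * qpoch_inf (Q ^+ 2) (Q ^+ 2).
  have h : forall n, (n <= n.*2)%N by move=> n; rewrite -addnn leq_addr.
  apply: (fps_cvg_unique (fps_cvg_sub h (qpoch_cvg Q Q0))).
  apply: eq_fps_cvg (fps_cvgM (qpoch_cvg Q Q20) (qpoch_cvg (Q ^+ 2) Q20)) => n.
  by rewrite /= qpoch_double.
have H : qpoch_inf Q Q * (qpoch_inf (- Q) Q * qpoch_inf Q (Q ^+ 2)) = qpoch_inf Q Q.
  by rewrite mulrA sqr [RHS]dbl; exact: mulrC.
exact: (mulrI (qpoch_inf_unit Q0 Q0) (etrans H (esym (mulr1 _)))).
Qed.

Lemma qpoch_inf_eulerV Q : Q 0%N = 0 ->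
  (qpoch_inf Q (Q ^+ 2))^-1 = qpoch_inf (- Q) Q.
Proof.
move=> /qpoch_inf_euler; move: (qpoch_inf _ _) (qpoch_inf _ _) => A B AB.
by apply: mulr1_eq; rewrite mulrC.
Qed.

(** * Euler's series for (-zQ; Q)_oo and its even part *)

Section EulerSeries.
Variable Q : {fps R}.
Hypothesis Q0 : Q 0%N = 0.

Let term z n := z ^+ n / qpoch Q Q n * Q ^+ 'C(n.+1, 2).
Definition euler_series z := fps_series (term z).

Let leq_tri n : (n <= 'C(n.+1, 2))%N.
Proof. by rewrite binS bin1 leq_addl. Qed.

Lemma euler_series_sums z : fps_sums (term z) (euler_series z).
Proof. exact: fps_sums_pow. Qed.

Lemma euler_series_rec z :
  euler_series z = (1 + z * Q) * euler_series (z * Q).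
Proof.
have S1 := euler_series_sums (z * Q).
(* The difference of terms at z and zQ carries a factor 1 - Q^n: it vanishes at n = 0, and at n+1 it
   cancels the last factor of (Q; Q)_(n+1), leaving zQ times the term of index n at zQ. *)
have S2 := fps_sums_recl (f := fun n => term z n - term (z * Q) n) _.
have {S2} := S2 (z * Q * euler_series (z * Q)).
have -> : term z 0 - term (z * Q) 0 = 0.
  by rewrite /term !expr0 subrr.
rewrite add0r => S2.
apply: (fps_sums_unique (euler_series_sums z)).
rewrite mulrDl mul1r.
apply: eq_fps_sums (fps_sumsD S1 (S2 _)) => [n|]; first by ring.
apply: eq_fps_sums (fps_sumsZ (z * Q) S1) => n.
rewrite /term (binS n.+1) bin1.
rewrite qpoch_invS // !exprMn !exprD !exprS; ring.
Qed.

(** Iterate the functional equation and let z Q^n tend to 0, where the series equals 1. *)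
Lemma euler_series_prod z : euler_series z = qpoch_inf (- (z * Q)) Q.
Proof.
have it n : euler_series z = qpoch (- (z * Q)) Q n * euler_series (z * Q ^+ n).
  elim: n => [|n {1}->]; first by rewrite qpoch0 mul1r mulr1.
  rewrite qpoch_recr euler_series_rec exprSr [z * (_ * _)]mulrA; ring.
have E0 : euler_series 0 = 1.
  apply: fps_sums_series; have := @fps_sums_recl _ (term 0) 0.
  have -> : term 0 0 = 1 by rewrite /term bin_small // qpoch0 !expr0 divr1 mulr1.
  rewrite addr0; apply.
  rewrite -(mul0r (euler_series 0)).
  apply: eq_fps_sums (fps_sumsZ 0 (euler_series_sums 0)) => n.
  by rewrite /term exprS !mul0r.
have Ec : fps_cvg (fun n => euler_series (z * Q ^+ n)) 1.
  rewrite -E0; apply: fps_cvg_comp (fps_cvg_geom z Q0) => n x y xy.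
  apply: fps_eqmod_sums (euler_series_sums x) (euler_series_sums y) => m.
  do 2!apply: fps_eqmodMr.
  exact: fps_eqmodX.
rewrite -[RHS]mulr1; apply: (fps_cvg_unique (fps_cvg_cst (euler_series z))).
by apply: eq_fps_cvg (fps_cvgM (qpoch_cvg _ Q0) Ec) => n; rewrite -it.
Qed.

(** Adding the series at z = 1 and z = -1 cancels odd terms and doubles even ones. Partial sums of
    even length keep each such pair together. *)
Lemma euler_series_even :
  fps_sums (fun j => 2 * (Q ^+ (j * j.*2.+1) / qpoch Q Q j.*2))
    (qpoch_inf (- Q) Q + qpoch_inf Q Q).
Proof.
have := fps_sumsD (euler_series_sums 1) (euler_series_sums (-1)).
rewrite !euler_series_prod mul1r mulN1r opprK => S.
have h : forall n, (n <= n.*2)%N by move=> n; rewrite -addnn leq_addr.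
apply: eq_fps_cvg (fps_cvg_sub h S) => N /=.
elim: N => [|N IHN]; first by rewrite !big_ord0.
rewrite doubleS !big_ord_recr /= IHN /term.
have -> : ('C(N.*2.+1, 2) = N * N.*2.+1)%N.
  by rewrite bin2 /= -doubleMr doubleK mulnC.
have sgn : (-1) ^+ N.*2 = 1 :> {fps R} by rewrite -mul2n exprM sqrrN !expr1n.
rewrite !expr1n [(-1) ^+ N.*2.+1]exprS sgn; ring.
Qed.

End EulerSeries.

(** * The two-variable series S(x, w) and its contiguous relations *)

Section PartialTheta.
Variable p : {fps R}.
Hypothesis p0 : p 0%N = 0.

Let term x w j :=
  x ^+ j * qpoch_inf (w * p ^+ j) p / qpoch p p j * p ^+ (j * j).
(* The S(x, w) of the header. *)
Definition theta2 x w := fps_series (term x w).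

Lemma theta2_sums x w : fps_sums (term x w) (theta2 x w).
Proof. by apply: fps_sums_pow => // -[|j] //; rewrite leq_pmulr. Qed.

Lemma theta2_contr x w :
  theta2 x w + w * theta2 (x * p) (w * p) = theta2 x (w * p).
Proof.
apply: fps_sums_unique (theta2_sums _ _).
apply: eq_fps_sums
  (fps_sumsD (theta2_sums x w) (fps_sumsZ w (theta2_sums (x * p) (w * p)))).
move=> j; rewrite /term (qpoch_inf_recl (w * p ^+ j)) //.
have -> : w * p ^+ j * p = w * p * p ^+ j by ring.
rewrite exprMn; ring.
Qed.

Lemma theta2_shift x w :
  theta2 x w = theta2 (x * p) w + x * p * theta2 (x * p ^+ 2) (w * p).
Proof.
have S1 := theta2_sums (x * p) w.
have S2 := theta2_sums (x * p ^+ 2) (w * p).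
(* This is the splitting 1 = p^j + (1 - p^j): the second part vanishes at j = 0, and (n+1)^2 = n^2 +
   2n + 1 turns x into x p^2 after reindexing. *)
have S3 := fps_sums_recl (f := fun n => term x w n - term (x * p) w n) _.
have {S3} := S3 (x * p * theta2 (x * p ^+ 2) (w * p)).
have -> : term x w 0 - term (x * p) w 0 = 0.
  by rewrite /term !expr0 subrr.
rewrite add0r => S3.
apply: (fps_sums_unique (theta2_sums x w)).
apply: eq_fps_sums (fps_sumsD S1 (S3 _)) => [n|]; first by ring.
apply: eq_fps_sums (fps_sumsZ (x * p) S2) => n; rewrite /term.
have -> : (n.+1 * n.+1 = n * n + n + n + 1)%N by lia.
have -> : w * p * p ^+ n = w * p ^+ n.+1 by rewrite exprS; ring.
rewrite qpoch_invS // !exprMn !exprD !exprS; ring.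
Qed.

Lemma theta2_dilate x : theta2 x (x * p) = theta2 (x * p) (x * p * p).
Proof.
have pp : x * p ^+ 2 = x * p * p by rewrite expr2 mulrA.
by rewrite theta2_shift pp theta2_contr.
Qed.

Lemma theta2_contr1 a : theta2 a (a * p) = 1.
Proof.
(* The value is found at a = 0, where only the term j = 0 survives; dilation invariance carries it
   to every a. *)
have <- : theta2 0 (0 * p) = 1.
  rewrite mul0r; apply: fps_sums_series; have := @fps_sums_recl _ (term 0 0) 0.
  have -> : term 0 0 0 = 1.
    by rewrite /term mul0r qpoch_inf0 // qpoch0 !expr0 divr1 !mulr1.
  rewrite addr0; apply.
  rewrite -(mul0r (theta2 0 0)).
  apply: eq_fps_sums (fps_sumsZ 0 (theta2_sums 0 0)) => n.
  by rewrite /term exprS !mul0r.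
apply: (fps_dilation_invariant (F := fun x => theta2 x (x * p)) a p0 _ theta2_dilate).
move=> n x y xy.
apply: fps_eqmod_sums (theta2_sums x (x * p)) (theta2_sums y (y * p)) => m.
do 2!apply: fps_eqmodMr.
apply: fps_eqmodM; first exact: fps_eqmodX.
apply: qpoch_inf_eqmod => //.
by do 2!apply: fps_eqmodMr.
Qed.

Lemma theta2_rec a : theta2 a a + a * theta2 (a * p) (a * p) = 1.
Proof. by rewrite theta2_contr theta2_contr1. Qed.

End PartialTheta.

(** * Truncation of Gauss's theta series in powers of Q *)

Section TruncatedGauss.
Variable Q : {fps R}.
Hypothesis Q0 : Q 0%N = 0.
Let Q20 : (Q ^+ 2) 0%N = 0. Proof. exact: fps_exp_low. Qed.
Let F k := theta2 (Q ^+ 2) (Q ^+ k.*2.+1) (Q ^+ k.*2.+1).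

Lemma partial_theta_gauss :
  2 * F 0 = 1 + qpoch_inf Q Q / qpoch_inf (- Q) Q.
Proof.
have euler := qpoch_inf_euler Q0.
have -> : 1 + qpoch_inf Q Q / qpoch_inf (- Q) Q
   = qpoch_inf Q (Q ^+ 2) * (qpoch_inf (- Q) Q + qpoch_inf Q Q).
  move: (qpoch_inf (- Q) Q) (qpoch_inf Q (Q ^+ 2)) (qpoch_inf Q Q) euler.
  by move=> A B C AB; rewrite (mulr1_eq AB) -AB; ring.
apply: fps_sums_unique (fps_sumsZ 2 (theta2_sums Q20 (Q ^+ 1) (Q ^+ 1))) _.
apply: eq_fps_sums (fps_sumsZ (qpoch_inf Q (Q ^+ 2)) (euler_series_even Q0)) => j.
have Uj1 := qpoch_unit (Q ^+ 2) j Q0.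
have Uj2 := qpoch_unit (Q ^+ 2) j Q20.
(* Both (Q; Q^2)_oo and (Q; Q)_(2j) contain (Q; Q^2)_j; cancelling it leaves (Q^(2j+1); Q^2)_oo /
   (Q^2; Q^2)_j, as in F(Q). *)
rewrite (qpoch_inf_split Q j Q20) qpoch_double -expr2 invrM // expr1.
have -> : (j * j.*2.+1 = j + 2 * (j * j))%N by rewrite -mul2n; lia.
rewrite exprD exprM.
rewrite -[in RHS](mulrK Uj1 (_ ^+ j)); ring.
Qed.

Lemma truncated_gauss k :
  1 + 2 * \sum_(1 <= j < k.+1) (-1) ^+ j * Q ^+ (j ^ 2)
  = qpoch_inf Q Q / qpoch_inf (- Q) Q
    + 2 * (-1) ^+ k * Q ^+ (k.+1 ^ 2) * F k.+1.
Proof.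
apply: truncated_theta_rec => // [i|].
  by rewrite -[RHS](theta2_rec Q20 (Q ^+ i.*2.+1)) -exprD addn2.
by rewrite partial_theta_gauss addrC addKr.
Qed.

End TruncatedGauss.

End QPochhammer.

Theorem theorem1p4 (R : comUnitRingType) (k r : nat)
    (hk : (0 < k)%N) (hr : (0 < r)%N) :
  let q : {fps R} := fpsX in
  qpoch_inf (- q) q
    * (1 + 2 * \sum_(1 <= j < k.+1) (-1) ^+ j * q ^+ (r * j ^ 2))
  = qpoch_inf (- q) q * qpoch_inf (q ^+ r) (q ^+ r)
      / qpoch_inf (- q ^+ r) (q ^+ r)
    + 2 * (-1) ^+ k * q ^+ (r * (k + 1) ^ 2)
      * (qpoch_inf (q ^+ r) (q ^+ (2 * r)) / qpoch_inf q (q ^+ 2))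
      * fps_series (fun j =>
          q ^+ ((2 * k + 2 * j + 3) * r * j)
          / (qpoch (q ^+ (2 * r)) (q ^+ (2 * r)) j
             * qpoch (q ^+ r) (q ^+ (2 * r)) (k + j + 1))).
Proof.
move=> q; have q0 : q 0%N = 0 by [].
clearbody q.
have Q0 : (q ^+ r) 0%N = 0 by apply: fps_exp_low.
have QE n : q ^+ (r * n) = (q ^+ r) ^+ n by rewrite exprM.
have -> : q ^+ (2 * r) = (q ^+ r) ^+ 2 by rewrite mulnC QE.
rewrite QE; under eq_bigr do rewrite QE.
have UP : qpoch_inf (q ^+ r) ((q ^+ r) ^+ 2) \is a GRing.unit.
  by apply: qpoch_inf_unit => //; apply: fps_exp_low.
rewrite addn1.
apply: (@cofactor_eq {fps R} _ _ _ _ _ _ _ _ _ (qpoch_inf_eulerV q0) UP).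
  exact: truncated_gauss.
(* It remains to sum the series to F(Q^(2k+3)) / (Q; Q^2)_oo, which is checked term by term. *)
apply: fps_sums_series.
have Q20 : ((q ^+ r) ^+ 2) 0%N = 0 by apply: fps_exp_low.
apply: eq_fps_sums (fps_sumsZ _ (theta2_sums Q20 _ _)) => j.
have -> : ((2 * k + 2 * j + 3) * r * j
    = r * (k.+1.*2.+1 * j + 2 * (j * j)))%N by rewrite -mul2n; lia.
rewrite QE; move: (q ^+ r) Q0 Q20 => Q Q0 Q20 {QE UP}.
have I0 : (Q * (Q ^+ 2) ^+ (k + j + 1)) 0%N = 0.
  by rewrite -exprM -exprS; apply: fps_exp_low.
(* After k+j+1 factors the tail starts at Q^(2k+2j+3), exactly the infinite product in the theta
   term of index j. *)
rewrite (qpoch_inf_split Q (k + j + 1) Q20).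
have -> : Q ^+ k.+1.*2.+1 * (Q ^+ 2) ^+ j = Q * (Q ^+ 2) ^+ (k + j + 1).
  by rewrite -!exprM -exprS -exprD; congr (_ ^+ _); rewrite -mul2n; lia.
have UI := qpoch_inf_unit I0 Q20.
have UD := qpoch_unit (Q ^+ 2) (k + j + 1) Q0.
have Uj := qpoch_unit (Q ^+ 2) j Q20.
have -> : Q ^+ (k.+1.*2.+1 * j + 2 * (j * j))
    = (Q ^+ k.+1.*2.+1) ^+ j * (Q ^+ 2) ^+ (j * j) by rewrite exprD !exprM.
exact: invr_split_mul.
Qed.
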